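(* Let $N_*=(N_{k,i})_{k\ge1,\,i\in\{1,2,3\}}$ be a sequence of positive integers and $\rho\in\,]0,1[$. Let $\ell \geq 1$ and $j\in\{0,\cdots,7\Omega_\ell-1\}$. Then $$\mathrm{d}_{Hauss}\left(\mathbf{n}^{\Phi}_{\infty}(\Gamma^j_\ell),\ \bigcup_{j'=j\frac{\Omega_{\ell+1}}{\Omega_\ell}}^{(j+1)\frac{\Omega_{\ell+1}}{\Omega_\ell}-1}\mathrm{rot}_{\ell+1}^{j'} \circ \mathbf{n}^{\Phi}_{\infty}(\Gamma_{\ell+1}^0)\right)\leq \frac{4\pi\, \mathrm{Lip}_\rho(\mathbf{F}_{\ell}^{\Phi})}{7\Omega_{\ell+1}}.$$
   Context: Points are given in polar coordinates $(\rho,\varphi)$, $0<\rho<1$, $\varphi\in\mathbb{R}/2\pi\mathbb{Z}$; tangent spaces are identified with $\mathbb{R}^2$ by the direct basis $(\partial_\rho,\partial_\varphi)$. $\wedge$ is the cross product in $\mathbb{E}^3$; $\Psi^*\langle\cdot,\cdot\rangle(v,w)=\langle\Psi v,\Psi w\rangle$. $J_0$ is the Bessel function of the first kind of order 0, $\kappa_0$ its first positive zero, $J_0^{-1}:\,]0,1]\to[0,\kappa_0[$ the inverse of $J_0|_{[0,\kappa_0[}$. $\mathrm d_{Hauss}$ is the Hausdorff distance between subsets of $\mathbb{E}^3$. Data. $a=\frac{7}{2\pi}$; $\varpi_1=-\rho$, $\varpi_2=\rho-a\varphi$, $\varpi_3=\rho+a\varphi$; $\ell_i=d\varpi_i$;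 for $B=E\,d\rho^2+F(d\rho\otimes d\varphi+d\varphi\otimes d\rho)+G\,d\varphi^2$, $H_1(B)=E-\frac{G}{a^2}$, $H_2(B)=\frac{G}{2a^2}-\frac{F}{2a}$, $H_3(B)=\frac{G}{2a^2}+\frac{F}{2a}$ (so $B=\sum_iH_i(B)\ell_i\otimes\ell_i$). $f_0(\rho,\varphi)=2(\rho\cos\varphi,\rho\sin\varphi,\frac{\sqrt2}{2}\rho^2)$, and $g_k=f_0^*\langle\cdot,\cdot\rangle+4\sum_{n=1}^k(n+2)\rho^{2(n+1)}d\rho^2+4\sum_{n=1}^k(n+1)\rho^{2(n+1)}d\varphi^2$. Frame of $(\Psi,\lambda)$. For an injective linear map $\Psi:\mathbb{R}^2\to\mathbb{E}^3$ and a nonzero linear form $\lambda$, let $(v,w)$ be a direct basis of $\mathbb{R}^2$ with $\lambda(v)>0$, $w\in\ker\lambda$; the frame is $(\mathbf t,\mathbf w,\mathbf n)$ with $\mathbf w=\frac{\Psi(w)}{\|\Psi(w)\|}$, $\mathbf n=\frac{\Psi(v)\wedge\Psi(w)}{\|\Psi(v)\wedge\Psi(w)\|}$, $\mathbf t=\mathbf w\wedge\mathbf n$. Formal corrugation process. For $\eta\ge0$ and an integer $N\ge1$, pointwise $FCP(\Phi,\eta,\varpi,N)=\Phi+\big(r(\cos\theta\,\mathbf t+\sin\theta\,\mathbf n)-\Phi(u)\big)\otimes d\varpi$, where $(\mathbf t,\mathbf w,\mathbf n)$ is the frame of $(\Phi,d\varpi)$, $u$ is the vector with $\Phi(u)$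 collinear to $\mathbf t$ and $d\varpi(u)=1$, $r=\sqrt{\eta+\|\Phi(u)\|^2}$, $\alpha=J_0^{-1}(\|\Phi(u)\|/r)$, $\theta=\alpha\cos(2\pi N\varpi)$. Formal analogue. $\Phi_{1,0}=df_0$, $\Phi_{k,i}=FCP(\Phi_{k,i-1},\eta_{k,i},\varpi_i,N_{k,i})$ with $\eta_{k,i}=H_i(g_k-\Phi_{k,i-1}^*\langle\cdot,\cdot\rangle)$, $i=1,2,3$, $\Phi_{k+1,0}=\Phi_{k,3}$. This sequence is well defined for every $N_*$ and converges on $0<\rho<1$ to a continuous field $\Phi_\infty$ of injective linear maps with $\Phi_\infty^*\langle\cdot,\cdot\rangle=4\frac{d\rho^2+\rho^2d\varphi^2}{(1-\rho^2)^2}$. $\mathbf n^\Phi_\infty$ is the unit normal $\mathbf n$ of $\Phi_\infty$ (third vector of the frame of $(\Phi_\infty,\ell_1)$). Further notation, for $\ell\ge1$. $\Omega_\ell$ is the greatest common divisor of all $N_{k,2},N_{k,3}$ with $k\ge\ell$ (so $\Omega_\ell$ divides $\Omega_{\ell+1}$). $\mathbf F_0^\Phi=\mathbf F_0$ is the frame of $(df_0,\ell_1)$ and $\mathbf F^\Phi_\ell$ the frame of $(\Phi_{\ell,3},\ell_1)$; $\mathrm{Lip}_\rho(\mathbf F^\Phi_\ell)$ is the Lipschitz constant of $\varphi\mapsto\mathbf F^\Phi_\ell(\rho,\varphi)$ (frames viewed as $3\times3$ orthogonal matrices, operator norm). $\mathrm{rot}_\ell^j$ is the rotation mapping the frame $\mathbf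 F^\Phi_{\ell-1}(\rho,0)$ to $\mathbf F^\Phi_{\ell-1}(\rho,\frac{2j\pi}{7\Omega_\ell})$. $\Gamma_\ell^j=\{(\rho,\varphi):\frac{2j\pi}{7\Omega_\ell}\le\varphi\le\frac{2(j+1)\pi}{7\Omega_\ell}\}$. *)

(* Defs.v *)
From HB Require Import structures.
From mathcomp Require Import all_boot all_order all_algebra.
From mathcomp Require Import all_classical all_reals all_analysis.

Set Implicit Arguments.
Unset Strict Implicit.
Unset Printing Implicit Defensive.

Import Order.TTheory GRing.Theory Num.Theory.
Import numFieldNormedType.Exports.

Local Open Scope classical_set_scope.
Local Open Scope ring_scope.

(* Conventions:
   - vectors of E^3 are columns, tangent vectors are columns in the basis
     (d/drho, d/dphi), linear forms are rows, a linear map R^2 -> E^3 is a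
     3 x 2 matrix and a symmetric bilinear form on R^2 is its Gram matrix;
   - the arc_end phi ranges over R, that is, objects on R/2piZ are handled through
     their 2pi-periodic lifts.  *)

(* The library norm on matrices is the sup norm, hence the definitions below. *)
Section Euclidean.
Variable R : realType.

Definition enorm n (x : 'cV[R]_n) : R := Num.sqrt (\sum_i x i 0 ^+ 2).

Definition cross (x y : 'cV[R]_3) : 'cV[R]_3 :=
  \col_(i < 3) [:: x 1 0 * y 2 0 - x 2 0 * y 1 0;
                   x 2 0 * y 0 0 - x 0 0 * y 2 0;
                   x 0 0 * y 1 0 - x 1 0 * y 0 0]`_i.

Definition normalize (x : 'cV[R]_3) : 'cV[R]_3 := (enorm x)^-1 *: x.

Definition opnorm n (M : 'M[R]_n) : R :=
  sup [set enorm (M *m x) | x in [set x : 'cV[R]_n | enorm x <= 1]].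

Definition hausdorff_dist n (A B : set 'cV[R]_n) : \bar R :=
  maxe (ereal_sup [set ereal_inf [set (enorm (a - b))%:E | b in B] | a in A])
       (ereal_sup [set ereal_inf [set (enorm (a - b))%:E | a in A] | b in B]).

Definition pullback (Psi : 'M[R]_(3, 2)) : 'M[R]_2 := Psi^T *m Psi.

Definition dform (f : R -> R -> R) (rho phi : R) : 'rV[R]_2 :=
  \row_(j < 2) [:: derive1 (fun r => f r phi) rho; derive1 (fun p => f rho p) phi]`_j.

End Euclidean.

Section Bessel.
Variable R : realType.

Definition J0 (x : R) : R :=
  lim (series (fun k => (-1) ^+ k * (x / 2) ^+ (2 * k) / (k`!%:R ^+ 2)) @ \oo).

Definition kappa0 : R := inf [set x : R | 0 < x /\ J0 x = 0].

Definition J0inv (y : R) : R :=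
  xget 0 [set x : R | 0 <= x < kappa0 /\ J0 x = y].

End Bessel.

Section Frame.
Variable R : realType.

Definition form_basis (lambda : 'rV[R]_2) : 'cV[R]_2 * 'cV[R]_2 :=
  xget (0, 0) [set vw : 'cV[R]_2 * 'cV[R]_2 |
    [/\ 0 < \det (row_mx vw.1 vw.2 : 'M[R]_2),
        0 < (lambda *m vw.1) 0 0
      & lambda *m vw.2 = 0]].

Definition frame_w (Psi : 'M[R]_(3, 2)) (lambda : 'rV[R]_2) : 'cV[R]_3 :=
  normalize (Psi *m (form_basis lambda).2).

Definition frame_n (Psi : 'M[R]_(3, 2)) (lambda : 'rV[R]_2) : 'cV[R]_3 :=
  normalize (cross (Psi *m (form_basis lambda).1)
                   (Psi *m (form_basis lambda).2)).

Definition frame_t (Psi : 'M[R]_(3, 2)) (lambda : 'rV[R]_2) : 'cV[R]_3 :=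
  cross (frame_w Psi lambda) (frame_n Psi lambda).

Definition frame (Psi : 'M[R]_(3, 2)) (lambda : 'rV[R]_2) : 'M[R]_3 :=
  row_mx (frame_t Psi lambda)
         (row_mx (frame_w Psi lambda) (frame_n Psi lambda)).

End Frame.

Section FormalCorrugation.
Variable R : realType.

Definition fcp_u (Phi : 'M[R]_(3, 2)) (lambda : 'rV[R]_2) : 'cV[R]_2 :=
  xget 0 [set u : 'cV[R]_2 |
    (exists c : R, Phi *m u = c *: frame_t Phi lambda) /\ lambda *m u = 1%:M].

(* [s] and [lambda] are the values at the current point of varpi, d varpi. *)
Definition FCP (Phi : 'M[R]_(3, 2)) (eta s : R) (lambda : 'rV[R]_2) (N : nat) :
    'M[R]_(3, 2) :=
  let Phiu := Phi *m fcp_u Phi lambda in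
  let r := Num.sqrt (eta + enorm Phiu ^+ 2) in
  let alpha := J0inv (enorm Phiu / r) in
  let theta := alpha * cos (2 * pi * N%:R * s) in
  Phi + (r *: (cos theta *: frame_t Phi lambda + sin theta *: frame_n Phi lambda)
         - Phiu) *m lambda.

End FormalCorrugation.

Section Data.
Variable R : realType.

Definition acst : R := 7 / (2 * pi).

(* Only the indices i = 1, 2, 3 are meaningful. *)
Definition varpi (i : nat) (rho phi : R) : R :=
  match i with
  | 1 => - rho
  | 2 => rho - acst * phi
  | _ => rho + acst * phi
  end.

Definition ell (i : nat) (rho phi : R) : 'rV[R]_2 := dform (varpi i) rho phi.

Definition Hcoef (i : nat) (B : 'M[R]_2) : R :=
  let E := B 0 0 in let F := B 0 1 in let G := B 1 1 in
  match i with
  | 1 => E - G / acst ^+ 2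
  | 2 => G / (2 * acst ^+ 2) - F / (2 * acst)
  | _ => G / (2 * acst ^+ 2) + F / (2 * acst)
  end.

Definition f0 (rho phi : R) : 'cV[R]_3 :=
  2 *: \col_(i < 3) [:: rho * cos phi; rho * sin phi;
                        Num.sqrt 2 / 2 * rho ^+ 2]`_i.

Definition df0 (rho phi : R) : 'M[R]_(3, 2) :=
  \matrix_(i < 3) dform (fun r p => f0 r p i 0) rho phi.

Definition gmet (k : nat) (rho phi : R) : 'M[R]_2 :=
  pullback (df0 rho phi)
  + (4 * \sum_(1 <= n < k.+1) (n + 2)%:R * rho ^+ (2 * (n + 1))) *: delta_mx 0 0
  + (4 * \sum_(1 <= n < k.+1) (n + 1)%:R * rho ^+ (2 * (n + 1))) *: delta_mx 1 1.

End Data.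

Section FormalAnalogue.
Variables (R : realType) (N : nat -> nat -> nat).

(* Phi_{k,i} in terms of Phi_{k,0}. *)
Fixpoint corrugate (k : nat) (Phi0 : R -> R -> 'M[R]_(3, 2)) (i : nat)
    (rho phi : R) : 'M[R]_(3, 2) :=
  match i with
  | 0 => Phi0 rho phi
  | i'.+1 =>
      let Psi := corrugate k Phi0 i' rho phi in
      FCP Psi (Hcoef i (gmet k rho phi - pullback Psi))
          (varpi i rho phi) (ell i rho phi) (N k i)
  end.

(* Phi_{m+1,0} *)
Fixpoint Phi_start (m : nat) : R -> R -> 'M[R]_(3, 2) :=
  match m with
  | 0 => @df0 R
  | m'.+1 => corrugate m (Phi_start m') 3
  end.

(* Phi_{k,i} for k >= 1 and i <= 3 *)
Definition Phi (k i : nat) : R -> R -> 'M[R]_(3, 2) :=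
  corrugate k (Phi_start k.-1) i.

Definition Phi_infty (rho phi : R) : 'M[R]_(3, 2) :=
  lim ((Phi k 0 rho phi) @[k --> \oo]).

Definition n_infty (p : R * R) : 'cV[R]_3 :=
  frame_n (Phi_infty p.1 p.2) (ell 1 p.1 p.2).

Definition Frm (l : nat) (rho phi : R) : 'M[R]_3 :=
  match l with
  | 0 => frame (df0 rho phi) (ell 1 rho phi)
  | _ => frame (Phi l 3 rho phi) (ell 1 rho phi)
  end.

(* The gcd of the N k 2 and N k 3, k >= l; every common divisor is at most
   N l 2 as soon as N l 2 is positive. *)
Definition Omega (l : nat) : nat :=
  \max_(d < (N l 2).+1 |
        `[< forall k, (l <= k)%N -> (d %| N k 2)%N /\ (d %| N k 3)%N >]) d.

(* The Lipschitz constant in [0, +oo]; it is the same for the arc-length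
   distance on R/2piZ as for the 2pi-periodic lift. *)
Definition Lip (rho : R) (l : nat) : \bar R :=
  ereal_sup [set (opnorm (Frm l rho pq.1 - Frm l rho pq.2)
                  / `|pq.1 - pq.2|)%:E
            | pq in [set pq : R * R | pq.1 != pq.2]].

Definition arc_end (l j : nat) : R := 2 * j%:R * pi / (7 * (Omega l)%:R).

Definition frame_rot (rho : R) (l j : nat) : 'M[R]_3 :=
  Frm l.-1 rho (arc_end l j) *m invmx (Frm l.-1 rho 0).

Definition Gamma (rho : R) (l j : nat) : set (R * R) :=
  [set p | p.1 = rho /\ arc_end l j <= p.2 <= arc_end l j.+1].

End FormalAnalogue.

(* Main.v *)
(* The corrugation process commutes with rotations of the target and adds
   eta dvarpi^2 to the pulled-back metric.  Hence the metric induced by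
   Phi_{k+1,0} is g_k, which does not depend on the angle, so that two values of
   Phi_{l+1,0} on the same circle differ by the rotation that maps one frame to
   the other.  Since a times the angle of Gamma_{l+1}^0 is 1 / Omega_{l+1} and
   the later frequencies N_{k,2}, N_{k,3} are multiples of Omega_{l+1}, the later
   corrugations are invariant under the shift by the initial angle d of
   Gamma_{l+1}^j'.  Therefore n_infty (s + d) = F_l (s + d) F_l (s)^-1 n_infty (s),
   and setting s = 0 in this rotation costs at most 2 s Lip (F_l), where
   s <= 2 pi / (7 Omega_{l+1}). *)

Require Import Defs.
From HB Require Import structures.
From mathcomp Require Import all_boot all_order all_algebra.
From mathcomp Require Import all_classical all_reals all_analysis.
From mathcomp Require Import ring lra.
Set Implicit Arguments.
Unset Strict Implicit.
Unset Printing Implicit Defensive.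
Import Order.TTheory GRing.Theory Num.Theory.
Import numFieldNormedType.Exports.
Local Open Scope classical_set_scope.
Local Open Scope ring_scope.

(** * Cases and sums over two and three indices *)

Lemma forall_ord2 (P : 'I_2 -> Prop) : P 0 -> P 1 -> forall i, P i.
Proof.
move=> P0 P1 [[|[|//]] Hi]; [have -> : Ordinal Hi = 0 | have -> : Ordinal Hi = 1] => //;
  exact: val_inj.
Qed.

Lemma forall_ord3 (P : 'I_3 -> Prop) : P 0 -> P 1 -> P 2 -> forall i, P i.
Proof.
move=> P0 P1 P2 [[|[|[|//]]] Hi];
  [have -> : Ordinal Hi = 0 | have -> : Ordinal Hi = 1 | have -> : Ordinal Hi = 2] => //;
  exact: val_inj.
Qed.

Lemma sum_ord2 (V : nmodType) (F : 'I_2 -> V) : \sum_i F i = F 0 + F 1.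
Proof.
rewrite !big_ord_recr big_ord0 /= add0r.
by congr (F _ + F _); exact: val_inj.
Qed.

Lemma sum_ord3 (V : nmodType) (F : 'I_3 -> V) : \sum_i F i = F 0 + F 1 + F 2.
Proof.
rewrite !big_ord_recr big_ord0 /= add0r.
by congr (F _ + F _ + F _); exact: val_inj.
Qed.

(** * Rotations of the Euclidean space *)

Section Vectors.
Variable R : realType.
Implicit Types x y z : 'cV[R]_3.

Definition dot n (x y : 'cV[R]_n) : R := (x^T *m y) 0 0.

Lemma dot_sum n (x y : 'cV[R]_n) : dot x y = \sum_i x i 0 * y i 0.
Proof. by rewrite /dot mxE; apply: eq_bigr => i _; rewrite mxE. Qed.

Lemma dotE x y : dot x y = x 0 0 * y 0 0 + x 1 0 * y 1 0 + x 2 0 * y 2 0.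
Proof. by rewrite dot_sum sum_ord3. Qed.

Lemma dotC n (x y : 'cV[R]_n) : dot x y = dot y x.
Proof. by rewrite !dot_sum; apply: eq_bigr => i _; rewrite mulrC. Qed.

Lemma dotZl n a (x y : 'cV[R]_n) : dot (a *: x) y = a * dot x y.
Proof. by rewrite /dot linearZ -scalemxAl mxE. Qed.

Lemma dotZr n a (x y : 'cV[R]_n) : dot x (a *: y) = a * dot x y.
Proof. by rewrite dotC dotZl dotC. Qed.

Lemma dotDl n (x y z : 'cV[R]_n) : dot (x + y) z = dot x z + dot y z.
Proof. by rewrite /dot linearD mulmxDl mxE. Qed.

Lemma dotDr n (x y z : 'cV[R]_n) : dot x (y + z) = dot x y + dot x z.
Proof. by rewrite dotC dotDl !(dotC x). Qed.

Lemma dot_ge0 n (x : 'cV[R]_n) : 0 <= dot x x.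
Proof. by rewrite dot_sum; apply: sumr_ge0 => i _; rewrite -expr2 sqr_ge0. Qed.

Lemma dot_mx11 n (x y : 'cV[R]_n) : x^T *m y = (dot x y)%:M.
Proof. by rewrite /dot -mx11_scalar. Qed.

Lemma enormE n (x : 'cV[R]_n) : enorm x = Num.sqrt (dot x x).
Proof.
by rewrite /enorm dot_sum; congr Num.sqrt; apply: eq_bigr => i _; rewrite expr2.
Qed.

Lemma enorm_sqr n (x : 'cV[R]_n) : enorm x ^+ 2 = dot x x.
Proof. by rewrite enormE sqr_sqrtr ?dot_ge0. Qed.

Lemma enorm_ge0 n (x : 'cV[R]_n) : 0 <= enorm x.
Proof. by rewrite enormE sqrtr_ge0. Qed.

Lemma enormN n (x : 'cV[R]_n) : enorm (- x) = enorm x.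
Proof. by rewrite !enormE -scaleN1r dotZl dotZr !mulN1r opprK. Qed.

Lemma crossE x y : (cross x y 0 0 = x 1 0 * y 2 0 - x 2 0 * y 1 0) *
  (cross x y 1 0 = x 2 0 * y 0 0 - x 0 0 * y 2 0) *
  (cross x y 2 0 = x 0 0 * y 1 0 - x 1 0 * y 0 0).
Proof. by do !split; rewrite mxE. Qed.

Lemma mx_entryE (m n : nat) : (forall (A B : 'M[R]_(m, n)) i j, (A + B) i j = A i j + B i j) *
  (forall (A : 'M[R]_(m, n)) i j, (- A) i j = - A i j) *
  (forall a (A : 'M[R]_(m, n)) i j, (a *: A) i j = a * A i j).
Proof. by do !split=> *; rewrite mxE. Qed.

Lemma vec3P x y : x 0 0 = y 0 0 -> x 1 0 = y 1 0 -> x 2 0 = y 2 0 -> x = y.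
Proof. by move=> e0 e1 e2; apply/matrixP => i j; rewrite ord1; move: i; exact: forall_ord3. Qed.

Lemma cross_crossr x y z : cross x (cross y z) = dot x z *: y - dot x y *: z.
Proof. by apply: vec3P; rewrite !(mx_entryE, crossE, dotE); ring. Qed.

Lemma crossC x y : cross x y = - cross y x.
Proof. by apply: vec3P; rewrite !(mx_entryE, crossE); ring. Qed.

Lemma cross_crossl x y z : cross (cross x y) z = dot x z *: y - dot y z *: x.
Proof. by rewrite crossC cross_crossr opprB !(dotC z). Qed.

Lemma dot_cross_crossr x y : dot (cross x y) y = 0.
Proof. by rewrite dotE !crossE; ring. Qed.

Lemma dot_cross_crossl x y : dot (cross x y) x = 0.
Proof. by rewrite dotE !crossE; ring. Qed.

Lemma crossZl a x y : cross (a *: x) y = a *: cross x y.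
Proof. by apply: vec3P; rewrite !(mx_entryE, crossE); ring. Qed.

Lemma crossZr a x y : cross x (a *: y) = a *: cross x y.
Proof. by rewrite crossC crossZl -scalerN -crossC. Qed.

Lemma dot_cross x y :
  dot (cross x y) (cross x y) = dot x x * dot y y - dot x y ^+ 2.
Proof. by rewrite !(dotE, crossE); ring. Qed.

(** Cauchy-Schwarz, read off from Lagrange's identity [dot_cross], whose left side is
    nonnegative. *)
Lemma dot_le_enorm x y : dot x y <= enorm x * enorm y.
Proof.
have := dot_ge0 (cross x y); rewrite dot_cross subr_ge0 -!enorm_sqr -exprMn => le.
apply: le_trans (ler_norm _) _.
by rewrite -ler_sqr ?nnegrE ?mulr_ge0 ?enorm_ge0 ?real_normK ?num_real.
Qed.

Lemma ler_enormD x y : enorm (x + y) <= enorm x + enorm y.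
Proof.
rewrite -ler_sqr ?nnegrE ?addr_ge0 ?enorm_ge0 // sqrrD !enorm_sqr !dotDl !dotDr.
by rewrite (dotC y x); have := dot_le_enorm x y; lra.
Qed.

(** An inequality rather than an equality: the inverse of 0 is 0, so the zero vector is normalized
    to itself. *)
Lemma enorm_normalize_le1 x : enorm (normalize x) <= 1.
Proof.
rewrite -(expr_le1 (n := 2)) ?enorm_ge0 // enorm_sqr dotZl dotZr -enorm_sqr.
have [->|x0] := eqVneq (enorm x) 0; first by rewrite invr0 mul0r ler01.
by rewrite mulrA -expr2 -exprMn mulVf ?expr1n.
Qed.

Lemma dot_normalize x : dot x x != 0 -> dot (normalize x) (normalize x) = 1.
Proof.
move=> x0; rewrite dotZl dotZr -enorm_sqr.
by rewrite mulrA -expr2 -exprMn mulVf ?expr1n // -(sqrf_eq0) enorm_sqr.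
Qed.

(* The cross product excludes the orthogonal maps of determinant -1. *)
Definition rotation (Q : 'M[R]_3) : Prop :=
  Q^T *m Q = 1%:M /\ {morph mulmx Q : x y / cross x y}.

Lemma rotation_trmxr (Q : 'M[R]_3) : rotation Q -> Q *m Q^T = 1%:M.
Proof. by move=> [QQ _]; exact: mulmx1C. Qed.

Lemma rotation_unitmx (Q : 'M[R]_3) : rotation Q -> Q \in unitmx.
Proof. by move=> /rotation_trmxr /mulmx1_unit []. Qed.

Lemma rotation_invmx (Q : 'M[R]_3) : rotation Q -> invmx Q = Q^T.
Proof.
move=> rQ; have uQ := rotation_unitmx rQ.
by rewrite -[LHS]mul1mx -rQ.1 -mulmxA mulmxV // mulmx1.
Qed.

Lemma rotation_tr (Q : 'M[R]_3) : rotation Q -> rotation Q^T.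
Proof.
move=> rQ; split=> [|x y]; first by rewrite trmxK rotation_trmxr.
have K : injective (mulmx Q : 'cV[R]_3 -> 'cV[R]_3).
  by apply: (can_inj (g := mulmx Q^T)) => z; rewrite mulmxA rQ.1 mul1mx.
by apply: K; rewrite (rQ.2) !mulmxA rotation_trmxr ?mul1mx.
Qed.

Lemma rotation_mul (Q S : 'M[R]_3) : rotation Q -> rotation S -> rotation (Q *m S).
Proof.
move=> [QQ Qx] [SS Sx]; split=> [|x y].
  by rewrite trmx_mul mulmxA -(mulmxA S^T) QQ mulmx1 SS.
by rewrite -!mulmxA Sx Qx.
Qed.

Lemma rotation_dot (Q : 'M[R]_3) x y : rotation Q -> dot (Q *m x) (Q *m y) = dot x y.
Proof. by move=> [QQ _]; rewrite /dot trmx_mul mulmxA -(mulmxA x^T) QQ mulmx1. Qed.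

Lemma rotation_enorm (Q : 'M[R]_3) x : rotation Q -> enorm (Q *m x) = enorm x.
Proof. by move=> rQ; rewrite !enormE rotation_dot. Qed.

Lemma rotation_normalize (Q : 'M[R]_3) x :
  rotation Q -> normalize (Q *m x) = Q *m normalize x.
Proof. by move=> rQ; rewrite /normalize rotation_enorm // scalemxAr. Qed.

Lemma row3E (t w n : 'cV[R]_3) i : (row_mx t (row_mx w n) i 0 = t i 0) *
  (row_mx t (row_mx w n) i 1 = w i 0) * (row_mx t (row_mx w n) i 2 = n i 0).
Proof.
have e0 : 0 = lshift 2 (0 : 'I_1) :> 'I_(1 + 2) by exact: val_inj.
have e1 : 1 = rshift 1 (lshift 1 (0 : 'I_1)) :> 'I_(1 + 2) by exact: val_inj.
have e2 : 2 = rshift 1 (rshift 1 (0 : 'I_1)) :> 'I_(1 + 2) by exact: val_inj.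
by rewrite {1}e0 {1}e1 {1}e2 !(row_mxEl, row_mxEr).
Qed.

Lemma mul_row3_mx (t w n x : 'cV[R]_3) :
  row_mx t (row_mx w n) *m x = x 0 0 *: t + x 1 0 *: w + x 2 0 *: n.
Proof.
by apply/matrixP => i j; rewrite ord1 !mx_entryE mxE sum_ord3 !row3E !(mulrC (x _ 0)).
Qed.

(** With [t = cross w n], the double product formulas give [cross t w = n] and [cross n t = w], so
    expanding a cross product bilinearly in the columns returns its coordinates. *)
Lemma rotation_row3 (w n : 'cV[R]_3) : dot w w = 1 -> dot n n = 1 -> dot w n = 0 ->
  rotation (row_mx (cross w n) (row_mx w n)).
Proof.
move=> ww nn wn; set t := cross w n.
have tw : cross t w = n by rewrite cross_crossl ww (dotC n) wn scale1r scale0r subr0.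
have nt : cross n t = w by rewrite cross_crossr nn (dotC n) wn scale1r scale0r subr0.
have Dt : dot t t = 1 by rewrite dot_cross ww nn wn expr0n subr0 mulr1.
have dtw : dot t w = 0 by exact: dot_cross_crossl.
have dtn : dot t n = 0 by exact: dot_cross_crossr.
split=> [|x y].
  apply/matrixP => i j; rewrite !mxE sum_ord3 ![_^T _ _]mxE.
  rewrite !dotE in ww nn wn Dt dtw dtn.
  move: i; apply: forall_ord3; move: j; apply: forall_ord3; rewrite !row3E /=; lra.
have expand : cross (x 0 0 *: t + x 1 0 *: w + x 2 0 *: n)
    (y 0 0 *: t + y 1 0 *: w + y 2 0 *: n) = cross x y 0 0 *: cross w n +
    cross x y 1 0 *: cross n t + cross x y 2 0 *: cross t w.
  by apply: vec3P; rewrite !(mx_entryE, crossE); ring.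
by rewrite !mul_row3_mx expand tw nt.
Qed.

End Vectors.

(** * Frames and the corrugation process *)

Section Frames.
Variable R : realType.
Implicit Types (Psi : 'M[R]_(3, 2)) (lambda : 'rV[R]_2).

Definition posdef (P : 'M[R]_2) := forall x : 'cV[R]_2, x != 0 -> 0 < (x^T *m P *m x) 0 0.

Lemma det_row2 (v w : 'cV[R]_2) :
  \det (row_mx v w : 'M[R]_2) = v 0 0 * w 1 0 - w 0 0 * v 1 0.
Proof.
have row2E i : (row_mx v w i 0 = v i 0) * (row_mx v w i 1 = w i 0).
  have e0 : 0 = lshift 1 (0 : 'I_1) :> 'I_(1 + 1) by exact: val_inj.
  have e1 : 1 = rshift 1 (0 : 'I_1) :> 'I_(1 + 1) by exact: val_inj.
  by rewrite {1}e0 {1}e1 row_mxEl row_mxEr.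
move: (row_mx v w : 'M[R]_2) row2E => A AE.
rewrite (expand_det_row _ 0) sum_ord2 /cofactor !det_mx11 !mxE.
have -> : lift 0 0 = 1 :> 'I_2 by exact: val_inj.
have -> : lift 1 0 = 0 :> 'I_2 by exact: val_inj.
by rewrite !AE /=; ring.
Qed.

(** Two forms on the plane that share a nonzero kernel vector are proportional, and evaluation at
    [u] gives the factor. This turns orthogonality relations in the frame into multiples of
    [lambda]. *)
Lemma row2_colinear (r lambda : 'rV[R]_2) (u w : 'cV[R]_2) :
    w != 0 -> r *m w = 0 -> lambda *m w = 0 -> (lambda *m u) 0 0 = 1 ->
  r = (r *m u) 0 0 *: lambda.
Proof.
move=> w0 rw lw lu.
have {}rw : r 0 0 * w 0 0 + r 0 1 * w 1 0 = 0.
  by have /matrixP/(_ 0 0) := rw; rewrite !mxE sum_ord2.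
have {}lw : lambda 0 0 * w 0 0 + lambda 0 1 * w 1 0 = 0.
  by have /matrixP/(_ 0 0) := lw; rewrite !mxE sum_ord2.
have {}lu : lambda 0 0 * u 0 0 + lambda 0 1 * u 1 0 = 1 by rewrite -lu mxE sum_ord2.
(* The determinant of the two forms vanishes: one cancels whichever coordinate of [w] is nonzero. *)
have rl : r 0 0 * lambda 0 1 = r 0 1 * lambda 0 0.
  have {w0} /orP[w0|w1] : (w 0 0 != 0) || (w 1 0 != 0).
  - rewrite -negb_and; apply: contra w0 => /andP[/eqP w0 /eqP w1].
    by apply/eqP/matrixP => i j; rewrite ord1 mxE; move: i; apply: forall_ord2.
  - apply: (mulIf w0); apply/eqP; rewrite -subr_eq0; apply/eqP.
    by rewrite -[RHS](mulr0 (lambda 0 1)) -[in RHS]rw -[LHS]addr0 -(mulr0 (r 0 1)) -lw; ring.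
  - apply: (mulIf w1); apply/eqP; rewrite -subr_eq0; apply/eqP.
    by rewrite -[RHS](mulr0 (r 0 0)) -[in RHS]lw -[LHS]addr0 -(mulr0 (lambda 0 0)) -rw; ring.
apply/matrixP => i j; rewrite ord1 [RHS]mxE mxE sum_ord2; move: j; apply: forall_ord2.
- by rewrite mulrDl -[LHS]mulr1 -lu mulrDr mulrAC [_ * _ * lambda 0 0]mulrAC -rl; ring.
- by rewrite -[LHS]mulr1 -lu mulrDr mulrA -rl; ring.
Qed.

Lemma form_basisP lambda : lambda != 0 ->
  [/\ 0 < \det (row_mx (form_basis lambda).1 (form_basis lambda).2 : 'M[R]_2),
      0 < (lambda *m (form_basis lambda).1) 0 0
    & lambda *m (form_basis lambda).2 = 0].
Proof.
move=> l0; pose p := lambda 0 0; pose q := lambda 0 1.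
have pq : 0 < p ^+ 2 + q ^+ 2.
  rewrite lt_neqAle addr_ge0 ?sqr_ge0 // andbT eq_sym paddr_eq0 ?sqr_ge0 // !sqrf_eq0.
  apply: contra l0 => /andP[/eqP p0 /eqP q0]; apply/eqP/matrixP => i j.
  by rewrite ord1 mxE; elim/forall_ord2: j; rewrite ?p0 ?q0.
(* Witnesses: the gradient of the form and its quarter turn; both positivity conditions become
   [p ^+ 2 + q ^+ 2 > 0]. *)
pose v : 'cV[R]_2 := lambda^T.
pose w : 'cV[R]_2 := \col_i if i == 0 then - q else p.
rewrite /form_basis; case: xgetP => [vw _ //|/(_ (v, w)) []].
split=> /=.
- by rewrite det_row2 !mxE /= -/p -/q mulNr opprK -!expr2.
- by rewrite mxE sum_ord2 !mxE -/p -/q -!expr2.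
- by apply/matrixP => i j; rewrite !ord1 mxE sum_ord2 !mxE -/p -/q /=; ring.
Qed.

Lemma dot_pullback Psi (x y : 'cV[R]_2) :
  dot (Psi *m x) (Psi *m y) = (x^T *m pullback Psi *m y) 0 0.
Proof. by rewrite /dot trmx_mul !mulmxA. Qed.

Lemma posdef_pullback_dot Psi (x : 'cV[R]_2) :
  posdef (pullback Psi) -> x != 0 -> 0 < dot (Psi *m x) (Psi *m x).
Proof. by rewrite dot_pullback => pd; exact: pd. Qed.

(** [form_basis] depends on [lambda] alone, and the norms and scalar products that build the frame
    are read off the Gram matrix. So [T] and [W] serve all maps inducing the same metric. *)
Lemma frame_metric lambda Psi : lambda != 0 -> posdef (pullback Psi) ->
  exists T W : 'cV[R]_2, [/\ (lambda *m T) 0 0 != 0, W != 0, lambda *m W = 0 &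
  forall Psi', pullback Psi' = pullback Psi ->
    [/\ frame_t Psi' lambda = Psi' *m T, frame_w Psi' lambda = Psi' *m W,
        (frame_n Psi' lambda)^T *m Psi' = 0 & rotation (frame Psi' lambda)]].
Proof.
move=> l0 pd; have [dvw lv lw] := form_basisP l0.
rewrite /frame /frame_t /frame_w /frame_n.
move: (form_basis lambda) dvw lv lw => [v w] /= dvw lv lw.
have w0 : w != 0.
  by apply: contraTneq dvw => ->; rewrite det_row2 !mxE mulr0 mul0r subrr ltxx.
have Bww : 0 < dot (Psi *m w) (Psi *m w) by exact: posdef_pullback_dot.
pose B (x y : 'cV[R]_2) := dot (Psi *m x) (Psi *m y).
(* [w /\ (v /\ w)], hence [t] up to a positive factor, is the image of [z]. *)
pose z := B w w *: v - B v w *: w.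
have lz : (lambda *m z) 0 0 = B w w * (lambda *m v) 0 0.
  by rewrite mulmxBr -!scalemxAr lw scaler0 subr0 mxE.
have lz0 : (lambda *m z) 0 0 != 0.
  by rewrite lz mulf_neq0 ?gt_eqF.
have z0 : z != 0 by apply: contraNneq lz0 => ->; rewrite mulmx0 mxE.
pose c Psi' : 'cV[R]_3 := cross (Psi' *m v) (Psi' *m w).
have cross_wc Psi' : pullback Psi' = pullback Psi ->
    cross (Psi' *m w) (c Psi') = Psi' *m z.
  move=> PP; rewrite cross_crossr mulmxBr -!scalemxAr /B.
  by rewrite !dot_pullback PP -!dot_pullback [dot (Psi *m w) (Psi *m v)]dotC.
have cc Psi' : pullback Psi' = pullback Psi -> dot (c Psi') (c Psi') = dot (c Psi) (c Psi).
  by move=> PP; rewrite !dot_cross !dot_pullback PP.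
(* [Psi *m z] is the cross product of the orthogonal vectors [Psi *m w] and [c Psi], so its positive
   squared norm is the product of theirs. *)
have cc_gt0 : 0 < dot (c Psi) (c Psi).
  have := posdef_pullback_dot pd z0; rewrite -cross_wc // dot_cross.
  rewrite (dotC (Psi *m w) (c Psi)) dot_cross_crossr expr0n subr0.
  by rewrite pmulr_rgt0.
exists (((enorm (Psi *m w))^-1 * (enorm (c Psi))^-1) *: z),
  ((enorm (Psi *m w))^-1 *: w); split.
- rewrite -scalemxAr mxE mulf_neq0 // mulf_neq0 // invr_eq0 enormE.
    by rewrite gt_eqF // sqrtr_gt0.
  by rewrite gt_eqF // sqrtr_gt0.
- by rewrite scaler_eq0 negb_or w0 andbT invr_eq0 enormE gt_eqF // sqrtr_gt0.
- by rewrite -scalemxAr lw scaler0.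
move=> Psi' PP; have eW : enorm (Psi' *m w) = enorm (Psi *m w).
  by rewrite !enormE !dot_pullback PP.
have ec : enorm (c Psi') = enorm (c Psi) by rewrite !enormE cc.
rewrite /normalize -/(c Psi') eW ec; split.
- by rewrite crossZl crossZr cross_wc // scalerA scalemxAr.
- by rewrite scalemxAr.
- rewrite linearZ -scalemxAl (_ : _ *m _ = 0) ?scaler0 //.
  (* The form given by the scalar product with the normal kills [w], hence is a multiple of
     [lambda]; it also kills [v], so the factor is 0. *)
  rewrite (@row2_colinear ((c Psi')^T *m Psi') lambda
    (((lambda *m v) 0 0)^-1 *: v) w) //.
  + by rewrite -scalemxAr -mulmxA dot_mx11 dot_cross_crossl scale_scalar_mx mulr0 mxE scale0r.
  + by rewrite -mulmxA dot_mx11 dot_cross_crossr raddf0.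
  + by rewrite -scalemxAr mxE mulVf // gt_eqF.
- have unit_scale (x : 'cV[R]_3) : 0 < dot x x ->
      dot ((enorm x)^-1 *: x) ((enorm x)^-1 *: x) = 1.
    by move=> x0; apply: dot_normalize; rewrite gt_eqF.
  apply: rotation_row3.
  + by rewrite -eW; apply: unit_scale; rewrite dot_pullback PP -dot_pullback.
  + by rewrite -ec; apply: unit_scale; rewrite cc.
  + by rewrite dotZl dotZr (dotC _ (c _)) dot_cross_crossr !mulr0.
Qed.

Lemma tr_row3_mul (t w n : 'cV[R]_3) p (A : 'M[R]_(3, p)) :
  (row_mx t (row_mx w n) : 'M[R]_3)^T *m A =
  col_mx (t^T *m A) (col_mx (w^T *m A) (n^T *m A)).
Proof. by rewrite -!mul_col_mx -!tr_row_mx. Qed.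

Lemma mul_mx_row3 (Q : 'M[R]_3) (t w n : 'cV[R]_3) :
  Q *m (row_mx t (row_mx w n) : 'M[R]_3) =
  row_mx (Q *m t) (row_mx (Q *m w) (Q *m n)).
Proof. by rewrite -!mul_mx_row. Qed.

Lemma rotation_row3_dot (t w n : 'cV[R]_3) : rotation (row_mx t (row_mx w n)) ->
  [/\ dot t t = 1, dot n n = 1, dot t w = 0 & dot t n = 0].
Proof.
move=> [/matrixP FF _].
by split; [have := FF 0 0|have := FF 2 2|have := FF 0 1|have := FF 0 2];
  rewrite !mxE sum_ord3 ![_^T _ _]mxE !row3E /= -dotE.
Qed.

(** By [frame_metric], the coordinates of a map in its own frame depend only on the induced
    metric. *)
Lemma isometric_rotation lambda (Psi1 Psi2 : 'M[R]_(3, 2)) :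
    lambda != 0 -> posdef (pullback Psi1) -> pullback Psi2 = pullback Psi1 ->
  Psi2 = frame Psi2 lambda *m (frame Psi1 lambda)^T *m Psi1.
Proof.
move=> l0 pd e2; have [T [W [_ _ _ TW]]] := frame_metric l0 pd.
have [t1 w1 n1 r1] := TW Psi1 erefl; have [t2 w2 n2 r2] := TW Psi2 e2.
rewrite -mulmxA (_ : (frame Psi1 lambda)^T *m Psi1 = (frame Psi2 lambda)^T *m Psi2).
  by rewrite mulmxA rotation_trmxr // mul1mx.
rewrite /frame !tr_row3_mul n1 n2 t1 t2 w1 w2 !trmx_mul -!mulmxA.
by rewrite -/(pullback Psi1) -/(pullback Psi2) e2.
Qed.

(** The frame is built from norms and cross products, which a rotation preserves. *)
Lemma frame_rotation (Q : 'M[R]_3) Psi lambda : rotation Q ->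
  [/\ frame_w (Q *m Psi) lambda = Q *m frame_w Psi lambda,
      frame_n (Q *m Psi) lambda = Q *m frame_n Psi lambda,
      frame_t (Q *m Psi) lambda = Q *m frame_t Psi lambda &
      frame (Q *m Psi) lambda = Q *m frame Psi lambda].
Proof.
move=> rQ; have ew : frame_w (Q *m Psi) lambda = Q *m frame_w Psi lambda.
  by rewrite /frame_w -mulmxA rotation_normalize.
have en : frame_n (Q *m Psi) lambda = Q *m frame_n Psi lambda.
  by rewrite /frame_n -!mulmxA -rQ.2 rotation_normalize.
have et : frame_t (Q *m Psi) lambda = Q *m frame_t Psi lambda.
  by rewrite /frame_t ew en -rQ.2.
by split=> //; rewrite /frame ew en et mul_mx_row3.
Qed.

Lemma pullback_rotation (Q : 'M[R]_3) Psi :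
  rotation Q -> pullback (Q *m Psi) = pullback Psi.
Proof. by move=> [QQ _]; rewrite /pullback trmx_mul mulmxA -(mulmxA Psi^T) QQ mulmx1. Qed.

(** The set from which [u] is chosen is unchanged by [Q], and so are the norm of the image of [u],
    the radius and the angle; only [t] and [n] are rotated. *)
Lemma FCP_rotation (Q : 'M[R]_3) Psi eta s lambda N : rotation Q ->
  FCP (Q *m Psi) eta s lambda N = Q *m FCP Psi eta s lambda N.
Proof.
move=> rQ; have [_ en et _] := frame_rotation Psi lambda rQ.
have eu : fcp_u (Q *m Psi) lambda = fcp_u Psi lambda.
  rewrite /fcp_u; congr xget; apply/seteqP; split=> u [[c eu] lu]; split=> //; exists c.
    by rewrite -[LHS]mul1mx -rQ.1 -!mulmxA (mulmxA Q) eu et -scalemxAr (mulmxA Q^T) rQ.1 mul1mx.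
  by rewrite -mulmxA eu et scalemxAr.
rewrite /FCP eu -mulmxA rotation_enorm // en et mulmxDr; congr (_ + _).
rewrite [RHS]mulmxA; congr (_ *m _); move: (frame_t Psi lambda) (frame_n Psi lambda) => t n.
by rewrite mulmxBr -scalemxAr mulmxDr -!scalemxAr.
Qed.

(** The process adds [(p t + q n) lambda]. Since [t^T Psi = c lambda] and [n^T Psi = 0], the metric
    gains [p^2 + q^2 + 2 p c] times the square of [lambda], which is [r^2 - c^2 = eta] by
    [cos^2 + sin^2 = 1]. *)
Lemma pullback_FCP Psi eta s lambda N : lambda != 0 -> posdef (pullback Psi) ->
  posdef (pullback Psi + eta *: (lambda^T *m lambda)) ->
  pullback (FCP Psi eta s lambda N) = pullback Psi + eta *: (lambda^T *m lambda).
Proof.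
move=> l0 pd pd'; have [T [W [lT W0 lW TW]]] := frame_metric l0 pd.
have {TW}[et ew en rF] := TW Psi erefl.
rewrite /FCP; set u := fcp_u _ _.
have [[c eu] lu] : (exists c : R, Psi *m u = c *: frame_t Psi lambda) /\ lambda *m u = 1%:M.
  rewrite /u /fcp_u; case: xgetP => [x _ //|/(_ (((lambda *m T) 0 0)^-1 *: T)) []].
  split; first by exists ((lambda *m T) 0 0)^-1; rewrite et scalemxAr.
  by rewrite -scalemxAr [lambda *m T]mx11_scalar scale_scalar_mx [_%:M 0 0]mxE eqxx mulr1n mulVf.
have [tt nn tw tn] := rotation_row3_dot rF.
have lu1 : (lambda *m u) 0 0 = 1 by rewrite lu mxE.
have tPsi : (frame_t Psi lambda)^T *m Psi = c *: lambda.
  rewrite [LHS](@row2_colinear _ lambda u W) //.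
    by rewrite -mulmxA eu -scalemxAr dot_mx11 tt mxE mxE eqxx mulr1.
  by rewrite -mulmxA -ew dot_mx11 tw raddf0.
have c2 : enorm (Psi *m u) ^+ 2 = c ^+ 2.
  by rewrite enorm_sqr eu dotZl dotZr tt mulr1 expr2.
have u0 : u != 0 by apply: contra_eq_neq lu1 => ->; rewrite mulmx0 mxE eq_sym oner_neq0.
(* This is the target metric evaluated at [u]; it ensures that the square root [r] squares back to
   [eta + c ^+ 2]. *)
have eta_c : 0 < eta + c ^+ 2.
  have := pd' u u0; rewrite mulmxDr mulmxDl mxE -dot_pullback -enorm_sqr c2 addrC.
  rewrite -scalemxAr -scalemxAl mxE mulmxA -trmx_mul -mulmxA.
  by rewrite -[X in _ * X]/(dot (lambda *m u) (lambda *m u)) dot_sum big_ord1 lu1 !mulr1.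
rewrite c2 eu; set r := Num.sqrt _; set theta := _ * cos _.
set t := frame_t _ _ in eu tt tw tn tPsi *; set n := frame_n _ _ in en nn tn *.
clearbody t n; pose p := r * cos theta - c; pose q := r * sin theta.
have r2 : r ^+ 2 = eta + c ^+ 2 by rewrite sqr_sqrtr // ltW.
have pq : p ^+ 2 + q ^+ 2 + 2 * p * c = eta.
  rewrite /p /q exprMn; have := cos2Dsin2 theta.
  have -> : eta = r ^+ 2 - c ^+ 2 by rewrite r2 addrK.
  move=> cs; have -> : sin theta ^+ 2 = 1 - cos theta ^+ 2 by rewrite -cs addrC addKr.
  by ring.
have -> : r *: (cos theta *: t + sin theta *: n) - c *: t = p *: t + q *: n.
  by rewrite scalerDr !scalerA addrAC -scalerBl.
have dd : (p *: t + q *: n)^T *m (p *: t + q *: n) = (p ^+ 2 + q ^+ 2)%:M.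
  by rewrite dot_mx11 !(dotDl, dotDr, dotZl, dotZr) (dotC n) tt nn tn; congr (_%:M); ring.
have dPsi : (p *: t + q *: n)^T *m Psi = (p * c) *: lambda.
  by rewrite linearD !linearZ mulmxDl -!scalemxAl tPsi en scaler0 addr0 scalerA.
have Psid : Psi^T *m (p *: t + q *: n) = (p * c) *: lambda^T.
  by rewrite -[LHS]trmxK trmx_mul trmxK dPsi linearZ.
move: (p *: t + q *: n) dd dPsi Psid => d dd dPsi Psid.
rewrite /pullback [(_ + _)^T]linearD /= trmx_mul mulmxDr !mulmxDl -!addrA; congr (_ + _).
rewrite mulmxA Psid -(mulmxA _ _ Psi) dPsi -mulmxA (mulmxA _ _ lambda) dd.
rewrite mul_scalar_mx -!scalemxAr -scalemxAl -!scalerDl -pq; congr (_ *: _); ring.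
Qed.

End Frames.

(** * The metrics of the formal analogue *)

Section Metrics.
Variable R : realType.

Definition sym_mx (E F G : R) : 'M[R]_2 :=
  \matrix_(i, j) if i == j then (if i == 0 then E else G) else F.

Lemma sym_mxE E F G : (sym_mx E F G 0 0 = E) * (sym_mx E F G 0 1 = F) *
  (sym_mx E F G 1 0 = F) * (sym_mx E F G 1 1 = G).
Proof. by do !split; rewrite mxE. Qed.

Lemma mx2P (A B : 'M[R]_2) : A 0 0 = B 0 0 -> A 0 1 = B 0 1 ->
  A 1 0 = B 1 0 -> A 1 1 = B 1 1 -> A = B.
Proof.
move=> e00 e01 e10 e11; apply/matrixP => i j.
by elim/forall_ord2: i; elim/forall_ord2: j.
Qed.

Lemma posdef_diag (E G : R) : 0 < E -> 0 < G -> posdef (sym_mx E 0 G).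
Proof.
move=> E0 G0 x x0.
have -> : (x^T *m sym_mx E 0 G *m x) 0 0 = E * x 0 0 ^+ 2 + G * x 1 0 ^+ 2.
  by rewrite mxE sum_ord2 !mxE !sum_ord2 !sym_mxE ![_^T _ _]mxE; ring.
have e0 : 0 <= E * x 0 0 ^+ 2 by rewrite pmulr_rge0 ?sqr_ge0.
have g0 : 0 <= G * x 1 0 ^+ 2 by rewrite pmulr_rge0 ?sqr_ge0.
rewrite lt_neqAle addr_ge0 // andbT eq_sym paddr_eq0 // !mulf_eq0 !orbb.
rewrite (gt_eqF E0) (gt_eqF G0) /=.
apply: contra x0 => /andP[/eqP x0 /eqP x1]; apply/eqP/matrixP => i j.
by rewrite ord1 mxE; elim/forall_ord2: i.
Qed.

Lemma posdefD (P : 'M[R]_2) eta (lambda : 'rV[R]_2) :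
  posdef P -> 0 <= eta -> posdef (P + eta *: (lambda^T *m lambda)).
Proof.
move=> pdP eta0 x x0; rewrite mulmxDr mulmxDl mxE ltr_pwDl ?pdP //.
rewrite -scalemxAr -scalemxAl mxE mulr_ge0 // mulmxA -trmx_mul -mulmxA.
exact: dot_ge0.
Qed.

Lemma acst_gt0 : 0 < acst R.
Proof. by rewrite divr_gt0 // mulr_gt0 ?pi_gt0. Qed.

Lemma derive1_linear (a b : R) (x : R) : derive1 (fun y => a * y + b) x = a.
Proof. by rewrite derive1E derive_val /GRing.scale /=; ring. Qed.

Lemma ell1E rho phi : ell 1 rho phi = \row_j (if j == 0 then -1 else 0) :> 'rV[R]_2.
Proof.
apply/matrixP => i j; rewrite !mxE; elim/forall_ord2: j => /=.
- rewrite (_ : (fun r : R => _) = (fun r => -1 * r + 0)) ?derive1_linear //.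
  by apply/funext => r; rewrite mulN1r addr0.
- exact: derive1_cst.
Qed.

Lemma ell2E rho phi : ell 2 rho phi = \row_j (if j == 0 then 1 else - acst R).
Proof.
apply/matrixP => i j; rewrite !mxE; elim/forall_ord2: j => /=.
- rewrite (_ : (fun r : R => _) = (fun r => 1 * r - acst R * phi)) ?derive1_linear //.
  by apply/funext => r; rewrite mul1r.
- rewrite (_ : (fun r : R => _) = (fun r => - acst R * r + rho)) ?derive1_linear //.
  by apply/funext => r; rewrite addrC mulNr.
Qed.

Lemma ell3E rho phi : ell 3 rho phi = \row_j (if j == 0 then 1 else acst R).
Proof.
apply/matrixP => i j; rewrite !mxE; elim/forall_ord2: j => /=.
- rewrite (_ : (fun r : R => _) = (fun r => 1 * r + acst R * phi)) ?derive1_linear //.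
  by apply/funext => r; rewrite mul1r.
- rewrite (_ : (fun r : R => _) = (fun r => acst R * r + rho)) ?derive1_linear //.
  by apply/funext => r; rewrite addrC.
Qed.

Lemma ell1_neq0 (rho phi : R) : ell 1 rho phi != 0.
Proof.
by apply/eqP => /matrixP/(_ 0 0)/eqP; rewrite ell1E !mxE /= oppr_eq0 oner_eq0.
Qed.

Lemma df0E (rho phi : R) :
  df0 rho phi = \matrix_(i < 3, j < 2) (if j == 0 then
      [:: 2 * cos phi; 2 * sin phi; 2 * Num.sqrt 2 * rho : R]`_i
    else [:: - (2 * rho * sin phi); 2 * rho * cos phi; 0 : R]`_i).
Proof.
apply/matrixP => i j; rewrite !mxE.
have f0E (r p : R) : (f0 r p 0 0 = (2 * cos p) * r + 0) *
    (f0 r p 1 0 = (2 * sin p) * r + 0) * (f0 r p 2 0 = Num.sqrt 2 * r ^+ 2).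
  by rewrite !mxE /=; do !split; rewrite ?mxE /=; field.
elim/forall_ord2: j; elim/forall_ord3: i => /=.
- by under eq_fun do rewrite f0E; rewrite derive1_linear.
- by under eq_fun do rewrite f0E; rewrite derive1_linear.
- by under eq_fun do rewrite f0E; rewrite derive1E derive_val /GRing.scale /=; ring.
- by under eq_fun do rewrite f0E; rewrite derive1E derive_val /GRing.scale /=; ring.
- by under eq_fun do rewrite f0E; rewrite derive1E derive_val /GRing.scale /=; ring.
- by under eq_fun do rewrite f0E; rewrite derive1_cst.
Qed.

Lemma pullback_df0 (rho phi : R) :
  pullback (df0 rho phi) = sym_mx (4 * (1 + 2 * rho ^+ 2)) 0 (4 * rho ^+ 2).
Proof.
have sq2 : Num.sqrt 2 ^+ 2 = 2 :> R by rewrite sqr_sqrtr.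
have cs := cos2Dsin2 phi.
have cs' : sin phi ^+ 2 = 1 - cos phi ^+ 2 by rewrite -cs addrC addKr.
by apply: mx2P; rewrite !sym_mxE mxE sum_ord3 ![_^T _ _]mxE df0E !mxE /=; ring: sq2 cs'.
Qed.

Definition gE k (rho : R) : R :=
  4 * (1 + 2 * rho ^+ 2) + 4 * \sum_(1 <= n < k.+1) (n + 2)%:R * rho ^+ (2 * (n + 1)).

Definition gG k (rho : R) : R :=
  4 * rho ^+ 2 + 4 * \sum_(1 <= n < k.+1) (n + 1)%:R * rho ^+ (2 * (n + 1)).

(** The rotational symmetry of the target metrics: [phi] disappears from the right side. *)
Lemma gmetE k (rho phi : R) : gmet k rho phi = sym_mx (gE k rho) 0 (gG k rho).
Proof.
rewrite /gmet pullback_df0; apply: mx2P; rewrite !mx_entryE !sym_mxE !mxE /=;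
 by rewrite ?mulr1 ?mulr0 ?addr0.
Qed.

Lemma gmet0 (rho phi : R) : gmet 0 rho phi = pullback (df0 rho phi).
Proof. by rewrite /gmet !big_geq // !mulr0 !scale0r !addr0. Qed.

Lemma gG_recr k rho : gG k.+1 rho = gG k rho + 4 * (k.+2%:R * rho ^+ (2 * k.+2)).
Proof. by rewrite /gG big_nat_recr //= mulrDr addrA !addn1. Qed.

Lemma gE_recr k rho : gE k.+1 rho = gE k rho + 4 * (k.+3%:R * rho ^+ (2 * k.+2)).
Proof.
by rewrite /gE big_nat_recr //= !addn1 !addn2 [4 * (\sum_(_ <= _ < _) _ + _)]mulrDr addrA.
Qed.

Lemma gG_gt0 k (rho : R) : 0 < rho -> 0 < gG k rho.
Proof.
move=> rho0; elim: k => [|k IH]; last first.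
  by rewrite gG_recr addr_gt0 // pmulr_rgt0 // pmulr_rgt0 ?ltr0n // exprn_gt0.
by rewrite /gG big_geq // mulr0 addr0 pmulr_rgt0 // exprn_gt0.
Qed.

(** For [k > 0] the left side is the last summand of [gE k] and the rest is positive; for [k = 0] it
    is the term [8 rho^2] of the initial metric. *)
Lemma gE_ge (k : nat) (rho : R) : 0 < rho < 1 ->
  4 * (k.+2%:R * rho ^+ (2 * k.+1)) < gE k rho.
Proof.
move=> /andP[rho0 rho1]; elim: k => [|k IH].
  by rewrite /gE big_geq // mulr0 addr0 ltr_pM2l // ltrDr.
have rho_ge0 := ltW rho0.
rewrite gE_recr ltr_pwDl //; apply: le_lt_trans IH.
by rewrite pmulr_rge0 // mulr_ge0 ?exprn_ge0.
Qed.

Lemma posdef_gmet m (rho phi : R) : 0 < rho < 1 -> posdef (gmet m rho phi).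
Proof.
move=> rho01; rewrite gmetE; have /andP[rho0 _] := rho01.
apply: posdef_diag; last exact: gG_gt0.
by apply: le_lt_trans (gE_ge m rho01); rewrite mulr_ge0 // mulr_ge0 // exprn_ge0 // ltW.
Qed.

(** From [pi < 4] one gets [acst > 7 / 8], and [49 / 64 > 1 / 2]. *)
Lemma acst_sqr_gt : 1 / 2 < acst R ^+ 2.
Proof.
have pi4 : pi < 4 :> R by have := @pihalf_lt2 R; lra.
have a1 : 7 / 8 < acst R.
  by rewrite ltr_pdivlMr ?mulr_gt0 ?pi_gt0 //; lra.
by nra.
Qed.

(* The coefficient of [drho^2] after the first corrugation.  The coefficient
   [eta_{k,1}] need not be shown nonnegative: [pi < 4] is enough for this. *)
Lemma stretched_E_gt0 k (rho : R) : 0 < rho < 1 ->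
  0 < gE k.+1 rho - (gG k.+1 rho - gG k rho) / acst R ^+ 2.
Proof.
move=> rho01; have /andP[rho0 rho1] := rho01.
have ge := gE_ge k rho01; rewrite gE_recr gG_recr [gG k rho + _]addrC addrK.
set x := rho ^+ (2 * k.+2).
have x0 : 0 < x by rewrite exprn_gt0.
have xle : x <= rho ^+ (2 * k.+1).
  by rewrite ler_wiXn2l ?ltW // leq_mul2l /= leqW.
have ge' : 4 * (k.+2%:R * x) < gE k rho.
  by apply: le_lt_trans ge; rewrite ler_pM2l // ler_pM2l ?ltr0n.
have ai : (acst R ^+ 2)^-1 < 2.
  by have := acst_sqr_gt; have := acst_gt0 => a0 a2; rewrite invf_plt ?posrE ?exprn_gt0 //; lra.
(* The loss is below [8 (k + 2) x]; it is paid by [4 (k + 2) x] from [gE k] and [4 (k + 3) x] from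
   the new summand. *)
have : 4 * (k.+2%:R * x) / acst R ^+ 2 < 4 * (k.+2%:R * x) * 2.
  by rewrite ltr_pM2l // pmulr_rgt0 // pmulr_rgt0 ?ltr0n.
have -> : k.+3%:R = k.+2%:R + 1 :> R by rewrite natr1.
rewrite mulrDl mul1r mulrDr; lra.
Qed.

(** The first corrugation leaves the defect [dG (drho^2 / a^2 + dphi^2)], whose coefficients [H_2]
    and [H_3] both equal [eta = dG / (2 a^2)]. As [H_3] vanishes on the square of [ell 2], the
    second corrugation keeps [H_3], and the third fills the remaining defect. *)
Lemma pullback_corrugate N k (rho phi : R) (Phi0 : R -> R -> 'M[R]_(3, 2)) :
    0 < rho < 1 -> pullback (Phi0 rho phi) = gmet k rho phi ->
  pullback (corrugate N k.+1 Phi0 3 rho phi) = gmet k.+1 rho phi.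
Proof.
move=> rho01 P0; have /andP[rho0 _] := rho01.
set a := acst R; have a0 : 0 < a by exact: acst_gt0.
have an0 : a != 0 by rewrite gt_eqF.
set dG := gG k.+1 rho - gG k rho.
have dG0 : 0 <= dG.
  by rewrite /dG gG_recr addrC addKr mulr_ge0 // mulr_ge0 ?exprn_ge0 // ltW.
have mE i j (P : 'M[R]_2) eta (lambda : 'rV[R]_2) :
    (P + eta *: (lambda^T *m lambda)) i j = P i j + eta * (lambda 0 i * lambda 0 j).
  by rewrite !mxE big_ord1 mxE.
have subE i j (A B : 'M[R]_2) : (A - B) i j = A i j - B i j by rewrite !mxE.
have l1 := ell1_neq0 rho phi.
have l2 : ell 2 rho phi != 0.
  by apply/eqP => /matrixP/(_ 0 0)/eqP; rewrite ell2E !mxE /= oner_eq0.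
have l3 : ell 3 rho phi != 0.
  by apply/eqP => /matrixP/(_ 0 0)/eqP; rewrite ell3E !mxE /= oner_eq0.
set Psi1 := corrugate N k.+1 Phi0 1 rho phi.
set eta := dG / (2 * a ^+ 2).
have eta0 : 0 <= eta by rewrite divr_ge0 // mulr_ge0 // exprn_ge0 // ltW.
set E1 := gE k.+1 rho - dG / a ^+ 2.
have E10 : 0 < E1 by exact: stretched_E_gt0.
have P1 : pullback Psi1 = sym_mx E1 0 (gG k rho).
  set eta1 := Hcoef 1 (gmet k.+1 rho phi - pullback (Phi0 rho phi)).
  have PE : pullback (Phi0 rho phi) + eta1 *: ((ell 1 rho phi)^T *m ell 1 rho phi) =
      sym_mx E1 0 (gG k rho).
    rewrite /eta1 P0 !gmetE /Hcoef -/a; apply: mx2P;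
    by rewrite mE ell1E !mx_entryE !sym_mxE !mxE /= /E1 /dG; field.
  rewrite -[LHS]/(pullback (FCP _ _ _ _ _)) -/eta1 pullback_FCP ?PE // ?P0.
    exact: posdef_gmet.
  by apply: posdef_diag => //; exact: gG_gt0.
have pd1 : posdef (pullback Psi1) by rewrite P1; apply: posdef_diag; rewrite ?gG_gt0.
set Psi2 := corrugate N k.+1 Phi0 2 rho phi.
have h2 : Hcoef 2 (gmet k.+1 rho phi - pullback Psi1) = eta.
  by rewrite P1 gmetE /Hcoef !mx_entryE !sym_mxE -/a /eta /dG; field.
have P2 : pullback Psi2 = pullback Psi1 + eta *: ((ell 2 rho phi)^T *m ell 2 rho phi).
  rewrite -[LHS]/(pullback (FCP _ _ _ _ _)) -/Psi1 h2 pullback_FCP //.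
  exact: posdefD.
have pd2 : posdef (pullback Psi2) by rewrite P2; exact: posdefD.
have h3 : Hcoef 3 (gmet k.+1 rho phi - pullback Psi2) = eta.
  rewrite P2 P1 gmetE /Hcoef !subE !mE ell2E !sym_mxE !mxE /= -/a /eta /dG.
  by field.
rewrite -[LHS]/(pullback (FCP _ _ _ _ _)) -/Psi2 h3 pullback_FCP //; last exact: posdefD.
rewrite P2 P1 gmetE; apply: mx2P;
  rewrite !mE ell2E ell3E !sym_mxE !mxE /= -/a /eta /E1 /dG; by field.
Qed.

Lemma pullback_Phi_start N m (rho phi : R) : 0 < rho < 1 ->
  pullback (Phi_start N m rho phi) = gmet m rho phi.
Proof.
move=> rho01; elim: m => [|m IH]; first by rewrite gmet0.
by rewrite -[LHS]/(pullback (corrugate _ _ _ 3 _ _)) pullback_corrugate.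
Qed.

End Metrics.

(** * Angular shifts *)

Section Invariance.
Variable R : realType.

Lemma cvg_mulmx m n (Q : 'M[R]_m.+1) (v : nat -> 'M[R]_(m.+1, n.+1)) M :
  v @ \oo --> M -> (Q *m v k) @[k --> \oo] --> Q *m M.
Proof.
move=> vM.
(* Left multiplication is a finite combination of coordinate functions with constant matrix
   coefficients, hence continuous. *)
have mulE A : Q *m A = \sum_i \sum_j A i j *: (Q *m delta_mx i j) :> 'M[R]_(m.+1, n.+1).
  rewrite {1}[A]matrix_sum_delta mulmx_sumr; apply: eq_bigr => i _.
  by rewrite mulmx_sumr; apply: eq_bigr => j _; rewrite -scalemxAr.
rewrite mulE; under eq_fun do rewrite mulE.
apply: (cvg_big add_continuous) => i _; apply: (cvg_big add_continuous) => j _.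
apply: cvgZ; last exact: cvg_cst.
by apply: (cvg_comp _ (fun A : 'M[R]_(m.+1, n.+1) => A i j) vM); exact: coord_continuous.
Qed.

(** As [Q] is invertible, the two sequences converge or diverge together. *)
Lemma lim_mulmx m n (Q : 'M[R]_m.+1) (u v : nat -> 'M[R]_(m.+1, n.+1)) :
    Q \in unitmx -> (\forall k \near \oo, u k = Q *m v k) ->
  lim (u @ \oo) = Q *m lim (v @ \oo).
Proof.
move=> uQ uv.
have cvgQ M : v @ \oo --> M -> u @ \oo --> Q *m M.
  move=> vM; apply: cvg_trans (cvg_mulmx (Q := Q) vM); apply: near_eq_cvg.
  by near=> k; apply/esym; near: k.
have [cv|dv] := pselect (cvg (v @ \oo)).
  have haus : hausdorff_space 'M[R]_(m.+1, n.+1) by exact: norm_hausdorff.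
  by have uQv := cvgQ _ cv; apply: (cvg_lim haus uQv).
have du : ~ cvg (u @ \oo).
  move=> cu; have {}cu := cvg_mulmx (Q := invmx Q) cu; apply: dv; apply/cvg_ex.
  exists (invmx Q *m lim (u @ \oo)); apply: cvg_trans cu; apply: near_eq_cvg.
  by near=> k; rewrite (near uv k) // mulKmx.
(* If there is no limit, [lim] is the default matrix, which is zero. *)
rewrite (dvgP du) (dvgP dv).
have -> : point = 0 :> 'M[R]_(m.+1, n.+1) by apply/matrixP => i j; rewrite !mxE.
by rewrite mulmx0.
Unshelve. all: by end_near. Qed.

(** * Divisibility of the frequencies and the induced periodicity *)

Variable N : nat -> nat -> nat.
Hypothesis N_gt0 : forall k i : nat, (1 <= k)%N -> (1 <= i <= 3)%N -> (0 < N k i)%N.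

(** A common divisor divides the positive [N l 2], so it lies in the range of the maximum; since 1
    is a common divisor, the maximum is attained by one. *)
Lemma Omega_spec l : (1 <= l)%N ->
  [/\ (0 < Omega N l)%N,
      forall k, (l <= k)%N -> (Omega N l %| N k 2)%N /\ (Omega N l %| N k 3)%N &
      forall d, (forall k, (l <= k)%N -> (d %| N k 2)%N /\ (d %| N k 3)%N) ->
        (d <= Omega N l)%N].
Proof.
move=> l1; have N2 : (0 < N l 2)%N by exact: N_gt0.
pose C d := `[< forall k, (l <= k)%N -> (d %| N k 2)%N /\ (d %| N k 3)%N >].
have le d : C d -> (d <= Omega N l)%N.
  move=> Cd; have dN : (d < (N l 2).+1)%N.
    by rewrite ltnS dvdn_leq //; have /asboolP/(_ l (leqnn _)) [] := Cd.
  exact: (@leq_bigmax_cond _ _ (fun d : 'I_(N l 2).+1 => d : nat) (Ordinal dN)).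
have C1 : C 1%N by apply/asboolP => k _; rewrite !dvd1n.
split; first exact: le.
- have : (0 < #|[pred d : 'I_(N l 2).+1 | C d]|)%N.
    have dN : (1 < (N l 2).+1)%N by rewrite ltnS.
    by apply/card_gt0P; exists (Ordinal dN).
  move=> /(eq_bigmax_cond (fun d : 'I_(N l 2).+1 => d : nat)) [d Cd eq].
  have -> : Omega N l = d by exact: eq.
  by move: Cd => /asboolP.
- by move=> d Cd; apply: le; apply/asboolP.
Qed.

(** Maximality is for the usual order. The lcm of both numbers still divides all later frequencies,
    so it is at most, hence equal to, [Omega N l.+1]. *)
Lemma Omega_dvd l : (1 <= l)%N -> (Omega N l %| Omega N l.+1)%N.
Proof.
move=> l1; have [w0 wd _] := Omega_spec l1.
have [w0' wd' wmax] := Omega_spec (leqW l1).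
have le : (lcmn (Omega N l) (Omega N l.+1) <= Omega N l.+1)%N.
  apply: wmax => k lk; have [a b] := wd k (ltnW lk); have [c d] := wd' k lk.
  by rewrite !dvdn_lcm a b c d.
have -> : Omega N l.+1 = lcmn (Omega N l) (Omega N l.+1).
  by apply/eqP; rewrite eqn_leq le andbT dvdn_leq ?lcmn_gt0 ?w0 // dvdn_lcmr.
exact: dvdn_lcml.
Qed.

Lemma cosB2pi (x : R) n : cos (x - 2 * pi * n%:R) = cos x.
Proof.
rewrite -[LHS](periodicn (@cosD2pi R) n); congr cos.
by rewrite -mulr_natr -[pi *+ 2]mulr_natr; ring.
Qed.

Lemma acst_arc_end l j : (1 <= l)%N -> acst R * arc_end R N l j = j%:R / (Omega N l)%:R.
Proof.
move=> l1; have [w0 _ _] := Omega_spec l1.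
have pi0 : pi != 0 :> R by rewrite gt_eqF ?pi_gt0.
have on0 : (Omega N l)%:R != 0 :> R by rewrite pnatr_eq0 -lt0n.
rewrite /acst /arc_end; move: pi pi0 => p p0.
by field; rewrite on0 p0.
Qed.

Lemma cos_varpi_shift l j k i rho phi : (1 <= l <= k)%N -> (1 <= i <= 3)%N ->
  cos (2 * pi * (N k i)%:R * varpi i rho (phi + arc_end R N l j)) =
  cos (2 * pi * (N k i)%:R * varpi i rho phi).
Proof.
move=> /andP[l1 lk]; have [w0 wd _] := Omega_spec l1.
have on0 : (Omega N l)%:R != 0 :> R by rewrite pnatr_eq0 -lt0n.
have [/dvdnP[m2 e2] /dvdnP[m3 e3]] := wd k lk.
case: i => [|[|[|[|//]]]] // _ /=.
(* The phase drops by [m2 * j] full turns; for [varpi 3] it grows by [m3 * j] turns, hence the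
   rewriting on the other side. *)
- rewrite (mulrDr (acst R)) acst_arc_end // e2 natrM.
  by rewrite -[RHS](cosB2pi _ (m2 * j)) natrM; congr cos; field.
- rewrite (mulrDr (acst R)) acst_arc_end // e3 natrM.
  by rewrite -[LHS](cosB2pi _ (m3 * j)) natrM; congr cos; field.
Qed.

Lemma FCP_cos (Psi : 'M[R]_(3, 2)) eta s s' lambda n :
    cos (2 * pi * n%:R * s) = cos (2 * pi * n%:R * s') ->
  FCP Psi eta s lambda n = FCP Psi eta s' lambda n.
Proof. by rewrite /FCP => ->. Qed.

(** The coefficient [eta] sees only metrics, which neither the shift nor [Q] changes, and the phase
    is periodic; so [Q] passes through each corrugation. *)
Lemma corrugate_shift l j k i (Q : 'M[R]_3) (Phi0 : R -> R -> 'M[R]_(3, 2)) rho phi :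
    (1 <= l <= k)%N -> (i <= 3)%N -> rotation Q ->
    Phi0 rho (phi + arc_end R N l j) = Q *m Phi0 rho phi ->
  corrugate N k Phi0 i rho (phi + arc_end R N l j) = Q *m corrugate N k Phi0 i rho phi.
Proof.
move=> lk i3 rQ Phi0Q; elim: i i3 => [//|i IH] i3.
have corrugateS psi : corrugate N k Phi0 i.+1 rho psi =
    FCP (corrugate N k Phi0 i rho psi)
      (Hcoef i.+1 (gmet k rho psi - pullback (corrugate N k Phi0 i rho psi)))
      (varpi i.+1 rho psi) (ell i.+1 rho psi) (N k i.+1) by [].
rewrite !corrugateS IH 1?ltnW // pullback_rotation // FCP_rotation //.
rewrite !gmetE (_ : ell i.+1 _ (_ + _) = ell i.+1 rho phi).
  by rewrite (FCP_cos _ _ _ (cos_varpi_shift j rho phi lk _)).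
by clear -i3; case: i i3 => [|[|[|//]]] _; rewrite ?ell1E ?ell2E ?ell3E.
Qed.

Lemma Phi_start_shift l j m (Q : 'M[R]_3) rho phi : rotation Q ->
    Phi_start N l rho (phi + arc_end R N l.+1 j) = Q *m Phi_start N l rho phi ->
  (l <= m)%N ->
  Phi_start N m rho (phi + arc_end R N l.+1 j) = Q *m Phi_start N m rho phi.
Proof.
move=> rQ lQ /subnKC <-; elim: (m - l)%N => [|p IH]; first by rewrite addn0.
by rewrite addnS; apply: corrugate_shift => //; rewrite /= ltnS leq_addr.
Qed.

Lemma n_infty_shift l j rho phi (Q : 'M[R]_3) : rotation Q ->
    Phi_start N l rho (phi + arc_end R N l.+1 j) = Q *m Phi_start N l rho phi ->
  n_infty N (rho, phi + arc_end R N l.+1 j) = Q *m n_infty N (rho, phi).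
Proof.
move=> rQ lQ; rewrite /n_infty /= !ell1E.
have -> : Phi_infty N rho (phi + arc_end R N l.+1 j) = Q *m Phi_infty N rho phi.
  apply: lim_mulmx; first exact: rotation_unitmx.
  (* [Phi N k 0] is [Phi_start N k.-1], so the relation starts at rank [l.+1]. *)
  exists l.+1 => // k /= lk; rewrite /Phi /=.
  by apply: Phi_start_shift => //; case: k lk.
by have [_ -> _ _] := frame_rotation (Phi_infty N rho phi) (\row_j (if j == 0 then -1 else 0)) rQ.
Qed.

End Invariance.

(** * Comparison of the rotations *)

Section Estimate.
Variable R : realType.

Lemma le_opnorm n (M : 'M[R]_n) (x : 'cV[R]_n) C :
    (forall y : 'cV[R]_n, enorm y <= 1 -> enorm (M *m y) <= C) -> enorm x <= 1 ->
  enorm (M *m x) <= opnorm M.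
Proof.
move=> MC x1; apply: ub_le_sup; last by exists x.
by exists C => _ [y y1 <-]; exact: MC.
Qed.

(** Both maps are isometries, so 2 bounds the set whose supremum is the operator norm. *)
Lemma rotationB_le_opnorm (F G : 'M[R]_3) x : rotation F -> rotation G ->
  enorm x <= 1 -> enorm ((F - G) *m x) <= opnorm (F - G).
Proof.
move=> rF rG; apply: (le_opnorm (C := 1 + 1)) => y y1; rewrite mulmxBl.
by rewrite (le_trans (ler_enormD _ _)) // enormN !rotation_enorm // lerD.
Qed.

(** Insert [C B^T x]: the remainder [C B^T x - C D^T x] is the image of [(D - B) B^T x] under the
    isometry [C D^T]. *)
Lemma enorm_frame_changeB (A B C D : 'M[R]_3) x :
    rotation B -> rotation C -> rotation D ->
  enorm (A *m B^T *m x - C *m D^T *m x) <=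
  enorm ((A - C) *m (B^T *m x)) + enorm ((D - B) *m (B^T *m x)).
Proof.
move=> rB rC rD; have rCD : rotation (C *m D^T).
  by apply: rotation_mul => //; exact: rotation_tr.
rewrite -(rotation_enorm ((D - B) *m _) rCD); apply: le_trans (ler_enormD _ _).
have -> : C *m D^T *m ((D - B) *m (B^T *m x)) = C *m (B^T *m x) - C *m D^T *m x.
  rewrite mulmxBl mulmxBr -!mulmxA (mulmxA D^T D) rD.1 mul1mx.
  by rewrite (mulmxA B) rotation_trmxr // mul1mx.
by rewrite mulmxBl addrA subrK mulmxA.
Qed.

(** Locates an angle of a large arc in one of its subarcs. *)
Lemma nat_bracket (f : nat -> R) (x : R) a b : (a < b)%N -> f a <= x <= f b ->
  exists2 j, (a <= j < b)%N & f j <= x <= f j.+1.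
Proof.
elim: b => // b IH; rewrite ltnS leq_eqVlt => /predU1P[<- fx|ab].
  by exists a; rewrite ?leqnn ?ltnSn.
move=> /andP[fa fb]; have [xb|bx] := leP x (f b).
  have [|j /andP[aj jb] fj] := IH ab; first by rewrite fa xb.
  by exists j => //; rewrite aj ltnW.
by exists b; rewrite ?ltnSn ?(ltnW ab) // (ltW bx).
Qed.

Variables (N : nat -> nat -> nat) (rho : R).
Hypothesis N_gt0 : forall k i : nat, (1 <= k)%N -> (1 <= i <= 3)%N -> (0 < N k i)%N.
Hypothesis rho01 : 0 < rho < 1.

Lemma posdef_Phi_start l phi : posdef (pullback (Phi_start N l rho phi)).
Proof. by rewrite pullback_Phi_start //; exact: posdef_gmet. Qed.

(** Both branches of [Frm] are the frame of Phi_{l+1,0}. *)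
Lemma FrmE l phi : Frm N l rho phi = frame (Phi_start N l rho phi) (ell 1 rho phi).
Proof. by case: l. Qed.

Lemma rotation_Frm l phi : rotation (Frm N l rho phi).
Proof.
rewrite FrmE.
have [T [W [_ _ _ TW]]] := frame_metric (ell1_neq0 rho phi) (posdef_Phi_start l phi).
by have [] := TW _ erefl.
Qed.

Lemma Phi_start_Frm l phi psi : Phi_start N l rho psi =
  Frm N l rho psi *m (Frm N l rho phi)^T *m Phi_start N l rho phi.
Proof.
rewrite !FrmE [ell 1 rho psi](_ : _ = ell 1 rho phi) ?ell1E //.
rewrite -!(ell1E rho phi); apply: isometric_rotation.
- exact: ell1_neq0.
- exact: posdef_Phi_start.
- by rewrite (pullback_Phi_start N l psi rho01) (pullback_Phi_start N l phi rho01) !gmetE.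
Qed.

Lemma Frm_Lip l phi psi x : enorm x <= 1 ->
  ((enorm ((Frm N l rho phi - Frm N l rho psi) *m x))%:E
    <= `|phi - psi|%:E * Lip N rho l)%E.
Proof.
(* [Lip] ranges over distinct angles; on the diagonal both sides vanish, as 0 times [+oo] is 0. *)
move=> x1; have [->|ne] := eqVneq phi psi.
  by rewrite !subrr mul0mx normr0 mul0e enormE /dot mulmx0 mxE sqrtr0.
have d0 : 0 < `|phi - psi| by rewrite normr_gt0 subr_eq0.
apply: (@le_trans _ _ (opnorm (Frm N l rho phi - Frm N l rho psi))%:E).
  by rewrite lee_fin; apply: rotationB_le_opnorm => //; exact: rotation_Frm.
apply: (@le_trans _ _ (`|phi - psi|%:E *
    (opnorm (Frm N l rho phi - Frm N l rho psi) / `|phi - psi|)%:E)%E).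
  by rewrite -EFinM mulrCA divff ?mulr1 // gt_eqF.
by apply: lee_wpmul2l => //; apply: ereal_sup_ubound; exists (phi, psi).
Qed.

Lemma Lip_ge0 l : (0 <= Lip N rho l)%E.
Proof.
have := @Frm_Lip l 1 0 0; rewrite mulmx0 subr0 normr1 mul1e enormE.
by rewrite /dot mulmx0 mxE sqrtr0; apply.
Qed.

Lemma enorm_n_infty p : enorm (n_infty N p) <= 1 :> R.
Proof. exact: enorm_normalize_le1. Qed.

Lemma n_infty_frame_rot l j s : 0 <= s <= arc_end R N l.+1 1 ->
  ((enorm (n_infty N (rho, (s + arc_end R N l.+1 j)%R)
      - frame_rot N rho l.+1 j *m n_infty N (rho, s)))%:E
    <= (4 * pi / (7 * (Omega N l.+1)%:R))%:E * Lip N rho l)%E.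
Proof.
move=> /andP[s0 s1]; set d := arc_end R N l.+1 j.
set n := n_infty N (rho, s); pose F := Frm N l rho.
have rF psi : rotation (F psi) by exact: rotation_Frm.
(* This rotation maps [n_infty] at [s] exactly to [n_infty] at [s + d]; [frame_rot] is the same
   expression at [s = 0]. *)
pose Q := F (s + d) *m (F s)^T.
have rQ : rotation Q by apply: rotation_mul => //; exact: rotation_tr.
rewrite (n_infty_shift N_gt0 rQ); last exact: Phi_start_Frm.
rewrite /frame_rot /= -/(F d) -/(F 0) (rotation_invmx (rF 0)) -/n.
pose x := (F s)^T *m n.
have x1 : enorm x <= 1.
  by rewrite rotation_enorm ?enorm_n_infty //; exact: rotation_tr.
apply: (@le_trans _ _ ((enorm ((F (s + d) - F d) *m x))%:E
    + (enorm ((F 0 - F s) *m x))%:E)%E).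
  by rewrite -EFinD lee_fin; apply: enorm_frame_changeB.
apply: (le_trans (leeD (Frm_Lip _ _ _ x1) (Frm_Lip _ _ _ x1))).
rewrite addrK sub0r normrN ger0_norm // -ge0_muleDl ?lee_fin //.
rewrite -EFinD; apply: lee_wpmul2r; first exact: Lip_ge0.
(* Each of the two frame differences spans the angle [s], at most 2 pi / (7 Omega_{l+1}). *)
rewrite lee_fin; apply: le_trans (lerD s1 s1) _.
by rewrite /arc_end -mulrDl mulr1; apply: ler_wpM2r; rewrite ?invr_ge0 ?mulr_ge0 //; lra.
Qed.

End Estimate.

(** * The two one-sided Hausdorff estimates *)

Theorem corollary7 (R : realType) (N : nat -> nat -> nat)
    (N_gt0 : forall k i : nat, (1 <= k)%N -> (1 <= i <= 3)%N -> (0 < N k i)%N)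
    (rho : R) (rho01 : 0 < rho < 1)
    (l : nat) (l_ge1 : (1 <= l)%N)
    (j : nat) (j_lt : (j < 7 * Omega N l)%N) :
  (hausdorff_dist
     (n_infty N @` Gamma N rho l j)
     (\bigcup_(j' in [set j' : nat |
         (j * (Omega N l.+1 %/ Omega N l) <= j'
            < j.+1 * (Omega N l.+1 %/ Omega N l))%N])
       [set frame_rot N rho l.+1 j' *m x | x in n_infty N @` Gamma N rho l.+1 0])
   <= (4 * pi / (7 * (Omega N l.+1)%:R))%:E * Lip N rho l)%E.
Proof.
have [w0 _ _] := Omega_spec N_gt0 l_ge1.
have [w0' _ _] := Omega_spec N_gt0 (leqW l_ge1).
set q := (Omega N l.+1 %/ Omega N l)%N.
have qE : Omega N l.+1 = (q * Omega N l)%N by rewrite divnK ?Omega_dvd.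
have q0 : (0 < q)%N by move: w0'; rewrite qE muln_gt0 => /andP[].
pose arc := arc_end R N l.+1.
have arcE i : arc i = i%:R * arc 1 by rewrite /arc /arc_end mulr1 [2 * i%:R]mulrC -!mulrA.
have arcS i : arc i.+1 = arc i + arc 1 by rewrite !(arcE i.+1) (arcE i) -natr1 mulrDl mul1r.
have arc0 : arc 0 = 0 by rewrite arcE mul0r.
have arc1 : 0 <= arc 1.
  by rewrite /arc /arc_end divr_ge0 ?mulr_ge0 ?pi_ge0.
have arc_le a b : (a <= b)%N -> arc a <= arc b.
  by move=> ab; rewrite (arcE a) (arcE b) ler_wpM2r // ler_nat.
(* Each arc of level [l] splits into exactly [q] arcs of level [l.+1]. *)
have arc_l i : arc_end R N l i = arc (i * q)%N.
  rewrite /arc /arc_end qE !natrM; field.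
  by rewrite !pnatr_eq0 -!lt0n q0 w0.
rewrite /hausdorff_dist ge_max; apply/andP; split; apply: ge_ereal_sup.
- move=> _ [_ [[r phi] [/= -> arc_phi] <-] <-].
  rewrite !arc_l in arc_phi.
  (* The point at [phi] in the subarc [j'] is compared with the rotated point at [phi - arc j']. *)
  have [|j' jj' arc_j'] := nat_bracket _ arc_phi; first by rewrite ltn_pmul2r.
  have s01 : 0 <= phi - arc j' <= arc 1.
    by move: arc_j'; rewrite arcS => /andP[? ?]; apply/andP; split; lra.
  apply: ereal_inf_le; exists (enorm (n_infty N (rho, phi)
      - frame_rot N rho l.+1 j' *m n_infty N (rho, phi - arc j')))%:E.
    exists (frame_rot N rho l.+1 j' *m n_infty N (rho, phi - arc j')) => //.
    exists j' => //; exists (n_infty N (rho, phi - arc j')) => //.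
    by exists (rho, phi - arc j') => //; split=> //=; rewrite -/(arc _) arc0.
  by have := n_infty_frame_rot N_gt0 rho01 (l := l) j' s01; rewrite subrK.
(* Conversely, the point at [s] rotated by [frame_rot] is compared with the point at [s + arc j'],
   which stays in the large arc because [j'.+1] is at most [j.+1 * q]. *)
- move=> _ [_ [j' /= /andP[jj' j'j] [_ [[r s] [/= -> s01] <-] <-]] <-].
  rewrite -!/(arc _) arc0 in s01; have /andP[s0 s1] := s01.
  apply: ereal_inf_le; exists (enorm (n_infty N (rho, s + arc j')
      - frame_rot N rho l.+1 j' *m n_infty N (rho, s)))%:E.
    exists (n_infty N (rho, s + arc j')) => //.
    exists (rho, s + arc j') => //; split=> //=; rewrite !arc_l.
    have := arc_le _ _ jj'; have := arc_le _ _ j'j; rewrite arcS => ? ?.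
    by apply/andP; split; lra.
  exact: n_infty_frame_rot.
Qed.
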